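(* Let $(p,\mathcal E)$ be a framework in $\mathbb R^d$ with data $\mathcal C,\mathcal V,\omega,\lambda,\kappa,\mu_0,L,\bar\mu$ as described in the context. Let $$\eta_1=\frac{4|\omega^TR(p)|}{\lambda},\qquad D=\frac{\eta_1}{L}\Big(\bar\mu^{1/2}+\frac{\eta_1}{L}\Big),$$ and suppose $D<\frac12$. Define $$\eta_2=\begin{cases}L\,\dfrac{(\bar\mu+4)^{1/2}-\bar\mu^{1/2}}{2}-\eta_1&\text{if }D<\frac14+\frac18\big(\bar\mu^{1/2}(\bar\mu+4)^{1/2}-\bar\mu\big),\\[2mm] L\,\dfrac{(\bar\mu+2)^{1/2}-\bar\mu^{1/2}}{2}&\text{otherwise.}\end{cases}$$ Then $\eta_2>\eta_1$, and any configuration $q\in\mathcal C^p$ with the same edge lengths as $p$ (i.e. $|q_i-q_j|=|p_i-p_j|$ for all $(i,j)\in\mathcal E$) such that $|q-p|>\eta_1$ must additionally satisfy $|q-p|\ge\eta_2$.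
   Context: A framework $(p,\mathcal E)$ in $\mathbb R^d$ consists of a configuration $p=(p_1,\dots,p_n)\in\mathbb R^{dn}$, $p_i\in\mathbb R^d$, and the set $\mathcal E$ of $m$ edges of a graph on vertices $1,\dots,n$. $|\cdot|$ is the Euclidean norm. For $q\in\mathbb R^{dn}$ the rigidity matrix $R(q)\in\mathbb R^{m\times dn}$ is defined by: the $(i,j)$-component of $R(q)u$ is $(q_i-q_j)\cdot(u_i-u_j)$ for $u\in\mathbb R^{dn}$, $(i,j)\in\mathcal E$. A stress is a vector $\omega\in\mathbb R^m$ with components $\omega_{ij}$; its stress matrix $\Omega=\Omega(\omega)\in\mathbb R^{dn\times dn}$ is the symmetric matrix with $u^T\Omega v=\sum_{(i,j)\in\mathcal E}\omega_{ij}(u_i-u_j)\cdot(v_i-v_j)$. $\mathcal T(p)$ is the space of trivial flexes at $p$ (velocities of infinitesimal rigid-body motions, $v_i=Ap_i+b$ with $A$ skew-symmetric, $b\in\mathbb R^d$). Data: $\mathcal C\subset\mathbb R^{dn}$ is a linear subspace complementary to $\mathcal T(p)$, and $\mathcal C^p=\{p+v:v\in\mathcal C\}$. $\mathcal V$ is a linear subspace with $\mathrm{Null}(R(p))\cap\mathcal C\subset\mathcal V\subset\mathcal C$. $\omega\in\mathbb R^m$ is a stress such that $V^T\Omega V\succ0$, where the columns of $V$ are an orthonormal basis of $\mathcal V$. Let $C$ be a matrix whose columns form an orthonormal basis of $\mathcal C$. Let $\lambda_0=\lambda_{\min}(V^T\Omega V)$ ($\lambda_0=+\infty$ if $\mathcal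 V=\{0\}$, in which case the condition on $\omega$ is vacuous) and $\mu_0=\lambda_{\min}(C^T\Omega C)$, where $\lambda_{\min}$ is the smallest eigenvalue. Choose $\lambda\in(0,\lambda_0)$, and let $\kappa$ be the smallest $\kappa\ge0$ such that $C^T\Omega C+2\kappa C^TR(p)^TR(p)C\succeq\lambda I$ (it exists). Let $z$ be the maximum degree of a vertex of the graph, and $L=\left(\frac{\lambda}{8z\kappa}\right)^{1/2}$, $\bar\mu=1-\frac{\mu_0}{\lambda}$. If $\kappa=0$ then $L=+\infty$, all terms with a factor $1/L$ are $0$ (so $D=0$), and $\eta_2=+\infty$. *)

(* Defs.v *)
(* MathComp / MathComp-Analysis *)
From HB Require Import structures.
From mathcomp Require Import all_boot all_order all_algebra.
From mathcomp Require Import boolp classical_sets reals ereal.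

Set Implicit Arguments.
Unset Strict Implicit.
Unset Printing Implicit Defensive.

Import Order.TTheory GRing.Theory Num.Theory.
Local Open Scope ring_scope.

(* Only used for row and column vectors.  The norm `|x| that MathComp-Analysis
   puts on matrices is the sup norm. *)
Definition enorm (R : realType) (a b : nat) (x : 'M[R]_(a, b)) : R :=
  Num.sqrt (\sum_i \sum_j x i j ^+ 2).

Definition dot (R : realType) (d : nat) (x y : 'cV[R]_d) : R :=
  \sum_a x a 0 * y a 0.

(* A point of R^(dn) is a column of height n * d; its i-th point p_i in R^d
   consists of the coordinates mxvec_index i a, a < d. *)
Definition pt (R : realType) (n d : nat) (p : 'cV[R]_(n * d)) (i : 'I_n) :
    'cV[R]_d :=
  \col_a p (mxvec_index i a) 0.

(* For a symmetric irreflexive adj, each undirected edge occurs once, as (i, j)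
   with i < j. *)
Definition edges (n : nat) (adj : rel 'I_n) : {set 'I_n * 'I_n} :=
  [set e : 'I_n * 'I_n | (e.1 < e.2)%N && adj e.1 e.2].

Definition max_degree (n : nat) (adj : rel 'I_n) : nat :=
  \max_(i < n) #|[set j | adj i j]|.

Section Matrices.
Variables (R : realType) (n d : nat) (adj : rel 'I_n).
Implicit Types (q u v : 'cV[R]_(n * d)) (e : 'I_#|edges adj|).

Definition edge_vec u e : 'cV[R]_d :=
  pt u (enum_val e).1 - pt u (enum_val e).2.

(* Column c is the image of the c-th standard basis vector; see rigidity_mxE. *)
Definition rigidity_mx q : 'M[R]_(#|edges adj|, n * d) :=
  \matrix_(e, c) dot (edge_vec q e) (edge_vec (delta_mx c 0) e).

(* The matrix of the bilinear form on the standard basis; see stress_mxE. *)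
Definition stress_mx (omega : 'cV[R]_#|edges adj|) : 'M[R]_(n * d) :=
  \matrix_(c, c')
    \sum_e omega e 0 * dot (edge_vec (delta_mx c 0) e)
                           (edge_vec (delta_mx c' 0) e).

Lemma edge_vec_delta u e a :
  edge_vec u e a 0 = \sum_c edge_vec (delta_mx c 0) e a 0 * u c 0.
Proof.
have H k : u (mxvec_index k a) 0 = \sum_c delta_mx c 0 (mxvec_index k a) (0 : 'I_1) * u c 0.
  rewrite (bigD1 (mxvec_index k a)) //= big1 => [|c ne].
    by rewrite addr0 mxE !eqxx mul1r.
  by rewrite mxE eq_sym (negPf ne) mul0r.
rewrite !mxE !H -sumrB; apply: eq_bigr => c _.
by rewrite !mxE mulrBl.
Qed.

Lemma rigidity_mxE q u e :
  (rigidity_mx q *m u) e 0 = dot (edge_vec q e) (edge_vec u e).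
Proof.
rewrite /dot; under [RHS]eq_bigr do rewrite (edge_vec_delta u) mulr_sumr.
rewrite exchange_big /= !mxE; apply: eq_bigr => c _.
by rewrite !mxE mulr_suml; apply: eq_bigr => a _; rewrite mulrA.
Qed.

Lemma stress_mxE (omega : 'cV[R]_#|edges adj|) u v :
  (u^T *m stress_mx omega *m v) 0 0 =
    \sum_e omega e 0 * dot (edge_vec u e) (edge_vec v e).
Proof.
have dotE e : dot (edge_vec u e) (edge_vec v e) =
    \sum_c' \sum_c u c 0 * dot (edge_vec (delta_mx c 0) e)
                               (edge_vec (delta_mx c' 0) e) * v c' 0.
  rewrite /dot; under eq_bigr do
    rewrite (edge_vec_delta u) (edge_vec_delta v) mulr_sumr.
  rewrite exchange_big /=; apply: eq_bigr => c' _.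
  under eq_bigr do rewrite mulr_suml.
  rewrite exchange_big /=; apply: eq_bigr => c _.
  rewrite mulr_sumr mulr_suml; apply: eq_bigr => a _.
  by rewrite !mulrA; congr (_ * _); rewrite -!mulrA mulrCA.
under eq_bigr do rewrite dotE mulr_sumr.
rewrite exchange_big /= mxE; apply: eq_bigr => c' _.
rewrite mxE mulr_suml.
under [RHS]eq_bigr do rewrite mulr_sumr.
rewrite [RHS]exchange_big /=; apply: eq_bigr => c _.
rewrite !mxE mulr_sumr mulr_suml; apply: eq_bigr => e _.
by rewrite !mulrA; congr (_ * _ * _); rewrite mulrC.
Qed.

End Matrices.

(* v_i = A p_i + b with A skew-symmetric *)
Definition trivial_flex (R : realType) (n d : nat) (p v : 'cV[R]_(n * d)) :
    Prop :=
  exists (A : 'M[R]_d) (b : 'cV[R]_d),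
    A^T = - A /\ forall i, pt v i = A *m pt p i + b.

Definition complementary (R : realType) (N : nat) (U : {vspace 'cV[R]_N})
    (T : 'cV[R]_N -> Prop) : Prop :=
  (forall w, exists u t, [/\ u \in U, T t & w = u + t]) /\
  (forall u, u \in U -> T u -> u = 0).

Definition orthonormal_basis_of (R : realType) (N k : nat)
    (U : {vspace 'cV[R]_N}) (B : 'M[R]_(N, k)) : Prop :=
  basis_of U [seq col j B | j <- enum 'I_k] /\ B^T *m B = 1%:M.

Definition psd (R : realType) (k : nat) (A : 'M[R]_k) : Prop :=
  A^T = A /\ forall x : 'cV[R]_k, 0 <= (x^T *m A *m x) 0 0.

Definition posdef (R : realType) (k : nat) (A : 'M[R]_k) : Prop :=
  A^T = A /\ forall x : 'cV[R]_k, x != 0 -> 0 < (x^T *m A *m x) 0 0.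

(* Used for symmetric A: the spectrum is finite, and nonempty when 0 < k, so
   the infimum is a minimum; for k = 0 it is +oo. *)
Definition lambda_min (R : realType) (k : nat) (A : 'M[R]_k) : \bar R :=
  ereal_inf [set a%:E | a in [set a : R | eigenvalue A a]]%classic.

Section Constants.
Variable R : realType.

Definition is_kappa (k N m : nat) (C : 'M[R]_(N, k)) (Omega : 'M[R]_N)
    (Rp : 'M[R]_(m, N)) (lambda kappa : R) : Prop :=
  let feasible (t : R) :=
    0 <= t /\
    psd (C^T *m Omega *m C + (2 * t) *: (C^T *m Rp^T *m Rp *m C) - lambda%:M) in
  feasible kappa /\ forall t, feasible t -> kappa <= t.

Definition ell (z : nat) (lambda kappa : R) : \bar R :=
  if kappa == 0 then +oo%E else (Num.sqrt (lambda / (8 * z%:R * kappa)))%:E.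

(* mu0 = +oo only if C^T Omega C is 0 x 0; then kappa = 0, so that D = 0 and
   eta2 = +oo whatever the value of mubar (here 1, as fine +oo = 0). *)
Definition mubar_of (lambda : R) (mu0 : \bar R) : R := 1 - fine mu0 / lambda.

Definition D_of (L : \bar R) (mubar eta1 : R) : R :=
  if L is l%:E then eta1 / l * (Num.sqrt mubar + eta1 / l) else 0.

Definition eta2_of (L : \bar R) (mubar eta1 : R) : \bar R :=
  if L is l%:E then
    (if D_of L mubar eta1
          < 1 / 4 + 1 / 8 * (Num.sqrt mubar * Num.sqrt (mubar + 4) - mubar)
     then l * ((Num.sqrt (mubar + 4) - Num.sqrt mubar) / 2) - eta1
     else l * ((Num.sqrt (mubar + 2) - Num.sqrt mubar) / 2))%:E
  else +oo%E.

End Constants.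

(* Main.v *)
Require Import Defs.
From HB Require Import structures.
From mathcomp Require Import all_boot all_order all_algebra.
From mathcomp Require Import boolp classical_sets reals ereal.
From mathcomp Require Import ring lra.

Set Implicit Arguments.
Unset Strict Implicit.
Unset Printing Implicit Defensive.

Import Order.TTheory GRing.Theory Num.Theory.
Local Open Scope ring_scope.

(** Write u = q - p and r = |u|, and let eta1 < r.  Equality of the edge lengths
    turns the linear term into a quadratic one, R(p) u = - 1/2 (|u_i - u_j|^2),
    which is used twice.  Pairing it with omega gives
      u^T Omega u = - 2 omega^T R(p) u <= (lambda eta1 / 2) r
    by Cauchy-Schwarz ([stress_energy_le]), and taking its norm gives
      |R(p) u|^2 <= z r^4,
    since the squared edge vectors of u sum to at most 2 z r^2 and each is at
    most 2 r^2 ([rigidity_isometric_le]).  The defining property of kappa on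
    calC ([kappa_coercive]) then yields
      lambda r^2 <= (lambda eta1 / 2) r + 2 kappa z r^4.
    As eta1 < r, the first term on the right is below lambda r^2 / 2, so the
    quartic term has to supply at least a quarter of lambda r^2: this forces
    kappa > 0 and r >= L ([separation]).  In particular no such q exists when
    kappa = 0, and otherwise r >= L >= eta2, because both gaps in the formula
    for eta2 are at most 1 ([eta2_le]).

    That eta1 < eta2 is arithmetic: g = (sqrt (mubar + c) - sqrt mubar) / 2 is
    the positive root of g (g + sqrt mubar) = c / 4, and the two conditions on D
    say that eta1 / L lies below g / 2 (for c = 4) or below g (for c = 2); see
    [eta1_lt_eta2].  This requires mubar >= 0, that is mu0 <= lambda.  If
    mu0 > lambda, then C^T Omega C - lambda I would be psd and kappa would be 0
    ([kappa_gt0_mubar]).  The step from a lower bound on the eigenvalues to a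
    lower bound on the quadratic form is [rayleigh_bound_attained]: the best
    lower bound of the Rayleigh quotient is itself an eigenvalue. *)

(** * Quadratic forms and the smallest eigenvalue *)

Local Notation form M x y := ((x^T *m M *m y) 0 0).

Section QuadraticForms.
Variable R : realType.

Lemma dotE k (x y : 'cV[R]_k) : dot x y = (x^T *m y) 0 0.
Proof. by rewrite /dot mxE; apply: eq_bigr => i _; rewrite mxE. Qed.

Lemma form1E k (x y : 'cV[R]_k) : form 1%:M x y = dot x y.
Proof. by rewrite mulmx1 dotE. Qed.

Lemma dot_ge0 k (x : 'cV[R]_k) : 0 <= dot x x.
Proof. by apply: sumr_ge0 => i _; rewrite -expr2 sqr_ge0. Qed.

Lemma sqr_le_dot k (x : 'cV[R]_k) i : x i 0 ^+ 2 <= dot x x.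
Proof.
rewrite /dot (bigD1 i) //= -expr2 lerDl.
by apply: sumr_ge0 => j _; rewrite -expr2 sqr_ge0.
Qed.

Lemma enorm_ge0 a b (x : 'M[R]_(a, b)) : 0 <= enorm x.
Proof. exact: sqrtr_ge0. Qed.

Lemma enorm_sqr k (x : 'cV[R]_k) : enorm x ^+ 2 = dot x x.
Proof.
rewrite sqr_sqrtr; last by do 2![apply: sumr_ge0 => ? _]; rewrite sqr_ge0.
by apply: eq_bigr => i _; rewrite big_ord1 expr2.
Qed.

Lemma enorm_tr a b (x : 'M[R]_(a, b)) : enorm x^T = enorm x.
Proof.
congr Num.sqrt; rewrite exchange_big; do 2![apply: eq_bigr => ? _].
by rewrite mxE.
Qed.

Lemma formC k (M : 'M[R]_k) (x y : 'cV[R]_k) : M^T = M -> form M x y = form M y x.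
Proof.
move=> sM; have -> : x^T *m M *m y = (y^T *m M *m x)^T.
  by rewrite !trmx_mul trmxK sM mulmxA.
by rewrite mxE.
Qed.

Lemma formD k (M : 'M[R]_k) (x y : 'cV[R]_k) s t : M^T = M ->
  form M (s *: x + t *: y) (s *: x + t *: y) =
    s ^+ 2 * form M x x + 2 * s * t * form M x y + t ^+ 2 * form M y y.
Proof.
move=> sM; have yx := formC x y sM.
rewrite [(_ + _)^T]linearD /= ![(_ *: _)^T]linearZ /= !mulmxDl.
rewrite !mulmxDr -!scalemxAl -!scalemxAr.
have D00 (P Q : 'M[R]_1) : (P + Q) 0 0 = P 0 0 + Q 0 0 by rewrite mxE.
have Z00 (a : R) (P : 'M[R]_1) : (a *: P) 0 0 = a * P 0 0 by rewrite mxE.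
by rewrite !(D00, Z00) -yx; ring.
Qed.

(** The form is only semidefinite, so the usual discriminant argument needs
    care when [form M y y = 0]: the form is then affine along the line x + t y,
    and boundedness below forces the slope to vanish. *)
Lemma form_cauchy_schwarz k (M : 'M[R]_k) (x y : 'cV[R]_k) : psd M ->
  form M x y ^+ 2 <= form M x x * form M y y.
Proof.
case=> sM pM; have a0 := pM x; have c0 := pM y.
set a := form M x x in a0 *; set b := form M x y; set c := form M y y in c0 *.
have Q s t : 0 <= s ^+ 2 * a + 2 * s * t * b + t ^+ 2 * c.
  by rewrite -formD //; apply: pM.
have [cp|cn] := ltP 0 c.
  have : 0 <= c * (a * c - b ^+ 2) by move: (Q c (- b)); lra.
  by rewrite pmulr_rge0 // subr_ge0.
have c_eq0 : c = 0 by apply/eqP; rewrite eq_le cn c0.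
have [->|b0] := eqVneq b 0; first by rewrite expr0n mulr_ge0.
(* the parameter at which the affine function a + 2 b t equals - 1 *)
have := Q 1 (- (a + 1) / (2 * b)).
have -> : 1 ^+ 2 * a + 2 * 1 * (- (a + 1) / (2 * b)) * b +
            (- (a + 1) / (2 * b)) ^+ 2 * c = - 1 by rewrite c_eq0; field.
by rewrite lerNr oppr0 ler10.
Qed.

Lemma psd1 k : psd (1%:M : 'M[R]_k).
Proof. by split=> [|x]; rewrite ?trmx1 // form1E dot_ge0. Qed.

Lemma dot_le_enorm k (x y : 'cV[R]_k) : `|dot x y| <= enorm x * enorm y.
Proof.
rewrite -ler_sqr ?nnegrE ?mulr_ge0 ?enorm_ge0 // real_normK ?num_real //.
rewrite exprMn !enorm_sqr -!form1E.
exact/form_cauchy_schwarz/psd1.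
Qed.

Lemma form_bounded k (M : 'M[R]_k) :
  exists2 K, 0 < K & forall x : 'cV[R]_k, `|form M x x| <= K * dot x x.
Proof.
exists (1 + \sum_j \sum_i `|M i j|) => [|x].
  by rewrite ltr_wpDr // sumr_ge0 // => j _; rewrite sumr_ge0.
rewrite mulrDl mul1r ler_wpDl ?dot_ge0 // mxE mulr_suml.
apply: le_trans (ler_norm_sum _ _ _) _; apply: ler_sum => j _.
rewrite mxE !mulr_suml; apply: le_trans (ler_norm_sum _ _ _) _.
apply: ler_sum => i _; rewrite mxE !normrM -mulrA mulrCA ler_wpM2l //.
have := sqr_le_dot x i; have := sqr_le_dot x j.
rewrite -(real_normK (num_real (x i 0))) -(real_normK (num_real (x j 0))).
by have := sqr_ge0 (`|x i 0| - `|x j 0|); nra.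
Qed.

(** Cauchy-Schwarz for the form of M, applied to x and M^-1 x, reads
    |x|^4 <= (x^T M x) (x^T M^-1 x), and the last factor is O(|x|^2).  This gives
    the spectral gap of an invertible psd matrix without diagonalising it. *)
Lemma psd_unitmx_coercive k (M : 'M[R]_k) : psd M -> M \in unitmx ->
  exists2 c, 0 < c & forall x : 'cV[R]_k, c * dot x x <= form M x x.
Proof.
move=> pM uM; have [K K0 Kb] := form_bounded (invmx M).
exists K^-1; first by rewrite invr_gt0.
move=> x; rewrite ler_pdivrMl //.
have [sM _] := pM; have := form_cauchy_schwarz x (invmx M *m x) pM.
rewrite mulmxA mulmxK // trmx_mul trmx_inv sM mulmxKV // -dotE.
rewrite mulmxA => cs.
have [xx0|xx0] := leP (dot x x) 0.
  by apply: le_trans xx0 _; rewrite mulr_ge0 ?(ltW K0) //; case: pM.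
rewrite -(ler_pM2r xx0) -expr2; apply: le_trans cs _.
rewrite [K * _]mulrC -mulrA; apply: ler_wpM2l; first by case: pM.
exact: le_trans (ler_norm _) (Kb x).
Qed.

Lemma form_sub_scalar k (A : 'M[R]_k) t (x : 'cV[R]_k) :
  form (A - t%:M) x x = form A x x - t * dot x x.
Proof.
rewrite mulmxBr mulmxBl [LHS]mxE mul_mx_scalar -scalemxAl.
by rewrite dotE; congr (_ + _); rewrite !mxE.
Qed.

Lemma tr_sub_scalar k (A : 'M[R]_k) t : A^T = A -> (A - t%:M)^T = A - t%:M.
Proof. by move=> sA; rewrite linearB /= tr_scalar_mx sA. Qed.

(** Take the largest m with m |x|^2 <= x^T A x for all x.  Were A - m invertible,
    [psd_unitmx_coercive] would allow m to be increased; so A - m is singular,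
    that is, m is an eigenvalue. *)
Lemma rayleigh_bound_attained k (A : 'M[R]_k.+1) : A^T = A ->
  exists2 m, eigenvalue A m & forall x : 'cV[R]_k.+1, m * dot x x <= form A x x.
Proof.
move=> sA.
pose E : set R :=
  [set t | forall x : 'cV[R]_k.+1, t * dot x x <= form A x x]%classic.
pose e0 : 'cV[R]_k.+1 := delta_mx 0 0.
have dp : 0 < dot e0 e0.
  by apply: lt_le_trans (sqr_le_dot _ 0); rewrite mxE !eqxx expr1n.
have bE : has_sup E.
  split.
    have [K _ Kb] := form_bounded A; exists (- K) => x.
    by rewrite mulNr lerNl; apply: le_trans (Kb x); rewrite -normrN ler_norm.
  exists (form A e0 e0 / dot e0 e0).
  by move=> t Et; rewrite ler_pdivlMr.
have supE x : sup E * dot x x <= form A x x.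
  have [d0|d0] := leP (dot x x) 0.
    have d_eq0 : dot x x = 0 by apply/eqP; rewrite eq_le d0 dot_ge0.
    by have [t Et] := bE.1; have := Et x; rewrite d_eq0 !mulr0.
  by rewrite -ler_pdivlMr //; apply: ge_sup bE.1 _ => t Et; rewrite ler_pdivlMr.
exists (sup E) => //.
apply: contraT => nev.
have uM : A - (sup E)%:M \in unitmx.
  by rewrite -row_free_unit -kermx_eq0; apply: contraNT nev.
have pM : psd (A - (sup E)%:M).
  split=> [|x]; first exact: tr_sub_scalar.
  by rewrite form_sub_scalar subr_ge0.
have [c c0 cb] := psd_unitmx_coercive pM uM.
have : sup E + c <= sup E.
  apply: sup_upper_bound bE _ _ => x; have := cb x.
  by rewrite form_sub_scalar mulrDl; lra.
by rewrite gerDl leNgt c0.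
Qed.

Lemma psd_sub_lambda_min k (A : 'M[R]_k) t : A^T = A ->
  (t%:E <= lambda_min A)%E -> psd (A - t%:M).
Proof.
move=> sA tA; split=> [|x]; first exact: tr_sub_scalar.
rewrite form_sub_scalar subr_ge0.
case: k => [|k] in A sA tA x *.
  by rewrite /dot [form _ _ _]mxE !big_ord0 mulr0.
have [m ev mb] := rayleigh_bound_attained sA.
apply: le_trans (mb x); rewrite ler_wpM2r ?dot_ge0 // -lee_fin.
by apply: le_trans tA _; apply: ereal_inf_lbound; exists m.
Qed.

Lemma orthonormal_coords N k (U : {vspace 'cV[R]_N}) (B : 'M[R]_(N, k)) u :
  orthonormal_basis_of U B -> u \in U ->
  exists2 y : 'cV[R]_k, u = B *m y & dot y y = dot u u.
Proof.
case=> bU oB uU.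
have [y uy] : exists y : 'cV[R]_k, u = B *m y.
  move: uU; rewrite -(span_basis bU) => uU.
  have sz : size [seq col j B | j <- enum 'I_k] == k.
    by rewrite size_map size_enum_ord.
  pose X := Tuple sz.
  exists (\col_j coord X j u).
  rewrite {1}(coord_span (X := X) uU); apply/colP => i; rewrite summxE mxE.
  apply: eq_bigr => j _; rewrite !mxE /= (nth_map j) ?size_enum_ord // nth_ord_enum.
  by rewrite mxE mulrC.
by exists y; rewrite // !dotE uy trmx_mul -mulmxA [B^T *m _]mulmxA oB mul1mx.
Qed.

End QuadraticForms.

(** * Edge vectors and rigidity of isometric displacements *)

Section EdgeVectors.
Variables (R : realType) (n d : nat) (adj : rel 'I_n).
Implicit Types (p q u : 'cV[R]_(n * d)) (e : 'I_#|edges adj|).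

Lemma edge_vecD p q e : edge_vec (p + q) e = edge_vec p e + edge_vec q e.
Proof. by apply/colP => a; rewrite !mxE; ring. Qed.

Lemma dotD_sqr k (x y : 'cV[R]_k) :
  dot (x + y) (x + y) = dot x x + 2 * dot x y + dot y y.
Proof.
rewrite /dot mulr_sumr -!big_split /=; apply: eq_bigr => a _.
by rewrite !mxE; ring.
Qed.

Lemma dotB_le k (x y : 'cV[R]_k) :
  dot (x - y) (x - y) <= 2 * (dot x x + dot y y).
Proof.
rewrite /dot -big_split mulr_sumr /=; apply: ler_sum => a _; rewrite !mxE.
by have := sqr_ge0 (x a 0 + y a 0); lra.
Qed.

Lemma sum_dot_pt u : \sum_i dot (pt u i) (pt u i) = dot u u.
Proof.
rewrite pair_bigA [RHS](reindex _ (curry_mxvec_bij _ _)) /=.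
by apply: eq_bigr => -[i a] _; rewrite !mxE.
Qed.

Lemma edgeP e :
  ((enum_val e).1 < (enum_val e).2)%N && adj (enum_val e).1 (enum_val e).2.
Proof. by have := enum_valP e; rewrite inE. Qed.

Lemma edge_vec_le u e : dot (edge_vec u e) (edge_vec u e) <= 2 * dot u u.
Proof.
apply: le_trans (dotB_le _ _) _; rewrite ler_pM2l //.
have /andP[ij _] := edgeP e; rewrite -sum_dot_pt.
rewrite (bigD1 (enum_val e).1) //= (bigD1 (enum_val e).2) /=; last first.
  by rewrite neq_ltn ij orbT.
by rewrite addrA lerDl sumr_ge0 // => k _; apply: dot_ge0.
Qed.

(** The handshake lemma with weights: each vertex i contributes f i once per
    incident edge, as first or as second endpoint according to the order on
    the vertices. *)
Lemma handshake_le (f : 'I_n -> R) : symmetric adj -> (forall i, 0 <= f i) ->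
  \sum_(e : 'I_#|edges adj|) (f (enum_val e).1 + f (enum_val e).2) <=
    (max_degree adj)%:R * \sum_i f i.
Proof.
move=> adjC f0.
rewrite -(big_enum_val (fun x : 'I_n * 'I_n => f x.1 + f x.2)) big_split /=.
have -> : \sum_(x in edges adj) f x.1 =
    \sum_(i < n) \sum_(j < n | (i < j)%N && adj i j) f i.
  by rewrite pair_big_dep /=; apply: eq_bigl => x; rewrite inE.
have -> : \sum_(x in edges adj) f x.2 =
    \sum_(i < n) \sum_(j < n | (j < i)%N && adj i j) f i.
  rewrite (exchange_big_dep xpredT) //= pair_big_dep /=; apply: eq_bigl => x.
  by rewrite inE [adj x.2 _]adjC.
rewrite -big_split mulr_sumr /=; apply: ler_sum => i _.
apply: (@le_trans _ _ (\sum_(j in [set j | adj i j]) f i)).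
  rewrite [X in X + _]big_mkcond [X in _ + X]big_mkcond [leRHS]big_mkcond.
  rewrite -big_split /=; apply: ler_sum => j _.
  by rewrite inE; case: ltngtP; case: (adj i j); rewrite /= ?addr0 ?add0r.
rewrite sumr_const -[leLHS]mulr_natl; apply: ler_wpM2r => //; rewrite ler_nat.
exact: (leq_bigmax i).
Qed.

(** One factor of each fourth power is bounded uniformly by [edge_vec_le]; the
    other is spread over the endpoints and summed with [handshake_le].  The two
    factors 2 make up the 4. *)
Lemma sum_edge_vec4_le u : symmetric adj ->
  \sum_(e : 'I_#|edges adj|) dot (edge_vec u e) (edge_vec u e) ^+ 2 <=
    4 * (max_degree adj)%:R * dot u u ^+ 2.
Proof.
move=> adjC.
apply: (@le_trans _ _ (\sum_(e : 'I_#|edges adj|) (2 * dot u u) *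
   (2 * (dot (pt u (enum_val e).1) (pt u (enum_val e).1)
       + dot (pt u (enum_val e).2) (pt u (enum_val e).2))))).
  apply: ler_sum => e _; rewrite expr2.
  by rewrite ler_pM ?dot_ge0 // ?edge_vec_le // dotB_le.
rewrite -!mulr_sumr.
have := handshake_le (f := fun i => dot (pt u i) (pt u i)) adjC (fun=> dot_ge0 _).
rewrite sum_dot_pt => hs; have := ler_wpM2l (dot_ge0 u) hs; lra.
Qed.

(** Expanding |p_e + u_e|^2 = |p_e|^2: the linear term of the length constraint
    equals minus half the quadratic one. *)
Lemma isometric_rigidity p u e :
  dot (edge_vec (p + u) e) (edge_vec (p + u) e) =
    dot (edge_vec p e) (edge_vec p e) ->
  (rigidity_mx adj p *m u) e 0 = - dot (edge_vec u e) (edge_vec u e) / 2.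
Proof. by rewrite rigidity_mxE edge_vecD dotD_sqr; lra. Qed.

End EdgeVectors.

Section IsometricDisplacement.
Variables (R : realType) (n d : nat) (adj : rel 'I_n).
Variables (p u : 'cV[R]_(n * d)).
Hypothesis adjC : symmetric adj.
Hypothesis iso : forall e : 'I_#|edges adj|,
  dot (edge_vec (p + u) e) (edge_vec (p + u) e) =
  dot (edge_vec p e) (edge_vec p e).

(** The second-order energy of u is thus linear in u, which bounds it by a
    multiple of |u| rather than of |u|^2. *)
Lemma stress_energy_isometric omega :
  form (stress_mx d omega) u u = - 2 * dot (omega^T *m rigidity_mx adj p)^T u.
Proof.
rewrite stress_mxE dotE trmxK -mulmxA mxE mulr_sumr; apply: eq_bigr => e _.
by rewrite (isometric_rigidity (iso e)) mxE; field.
Qed.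

Lemma stress_energy_le omega :
  form (stress_mx d omega) u u <=
    2 * enorm (omega^T *m rigidity_mx adj p) * enorm u.
Proof.
rewrite stress_energy_isometric -enorm_tr.
have := dot_le_enorm (omega^T *m rigidity_mx adj p)^T u.
by rewrite ler_norml => /andP[]; lra.
Qed.

Lemma rigidity_isometric_le :
  dot (rigidity_mx adj p *m u) (rigidity_mx adj p *m u) <=
    (max_degree adj)%:R * enorm u ^+ 4.
Proof.
rewrite -[4%N]/(2 * 2)%N exprM enorm_sqr.
have := sum_edge_vec4_le u adjC.
rewrite {1}/dot.
under [X in _ -> X <= _]eq_bigr do rewrite (isometric_rigidity (iso _)).
have -> : \sum_(e : 'I_#|edges adj|) (- dot (edge_vec u e) (edge_vec u e) / 2) *
   (- dot (edge_vec u e) (edge_vec u e) / 2) =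
  (\sum_(e : 'I_#|edges adj|) dot (edge_vec u e) (edge_vec u e) ^+ 2) / 4.
  by rewrite mulr_suml; apply: eq_bigr => e _; field.
lra.
Qed.

End IsometricDisplacement.

(** * The thresholds eta1, eta2 and L *)

Section Numbers.
Variable R : realType.

(** g is the nonnegative root of X^2 + sqrt mu X - c / 4; the formula for eta2
    uses c = 4 and c = 2. *)
Lemma root_gap (mu c : R) : 0 <= mu -> 0 <= c ->
  let g := (Num.sqrt (mu + c) - Num.sqrt mu) / 2 in
  [/\ 0 <= g, g * (Num.sqrt mu + g) = c / 4 & g <= Num.sqrt c / 2].
Proof.
move=> m0 c0 g.
have mc0 : 0 <= mu + c by rewrite addr_ge0.
have t2 := sqr_sqrtr mc0; have s2 := sqr_sqrtr m0; have c2 := sqr_sqrtr c0.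
have t0 := sqrtr_ge0 (mu + c); have s0 := sqrtr_ge0 mu; have r0 := sqrtr_ge0 c.
rewrite /g; split.
- by rewrite divr_ge0 // subr_ge0 ler_sqrt // lerDl.
- have cE : c = Num.sqrt (mu + c) ^+ 2 - Num.sqrt mu ^+ 2 by rewrite t2 s2; ring.
  by rewrite [in RHS]cE; field.
- rewrite ler_pM2r ?invr_gt0 // lerBlDr -ler_sqr ?nnegrE ?addr_ge0 // t2.
  have := mulr_ge0 s0 r0; rewrite sqrrD s2 c2; lra.
Qed.

Lemma lt_of_lt_quad (s e g : R) : 0 <= s -> 0 <= e -> 0 <= g ->
  e * (s + e) < g * (s + g) -> e < g.
Proof.
move=> s0 e0 g0; apply: contraTT; rewrite -!leNgt => ge.
by rewrite ler_pM // ?addr_ge0 // lerD2l.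
Qed.

Lemma eta1_lt_eta2 (l mu eta1 : R) : 0 < l -> 0 <= mu -> 0 <= eta1 ->
  D_of l%:E mu eta1 < 1 / 2 -> (eta1%:E < eta2_of l%:E mu eta1)%E.
Proof.
move=> l0 m0 e0; rewrite /eta2_of; set D := D_of _ _ _ => D12.
have defD : D = eta1 / l * (Num.sqrt mu + eta1 / l) by [].
have el0 : 0 <= eta1 / l by rewrite divr_ge0 // ltW.
have s0 := sqrtr_ge0 mu.
rewrite lte_fin; case: ifP => [Dlt|_].
- have [g0 gE _] := root_gap m0 (ler0n R 4); set g := (_ / 2) in g0 gE *.
  have g2 : Num.sqrt (mu + 4) = 2 * g + Num.sqrt mu by rewrite /g; field.
  have s2 := sqr_sqrtr m0.
  (* eta1 < l g - eta1 amounts to eta1 / l < g / 2, and the threshold on D is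
     the value of X (sqrt mu + X) at X = g / 2 *)
  suff : eta1 / l < g / 2 by rewrite ltr_pdivrMr //; lra.
  apply: (lt_of_lt_quad s0) => //; first by rewrite divr_ge0.
  rewrite -defD; apply: lt_le_trans Dlt _; rewrite g2.
  by rewrite -[X in _ - X]s2; nra.
- have [g0 gE _] := root_gap m0 (ler0n R 2).
  rewrite mulrC -ltr_pdivrMr //; apply: (lt_of_lt_quad s0) => //.
  by rewrite gE -defD; apply: lt_le_trans D12 _; lra.
Qed.

Lemma eta2_le (l mu eta1 : R) : 0 < l -> 0 <= mu -> 0 <= eta1 ->
  (eta2_of l%:E mu eta1 <= l%:E)%E.
Proof.
move=> l0 m0 e0; rewrite /eta2_of lee_fin.
have gap c : 0 <= c -> c <= 4 ->
    l * ((Num.sqrt (mu + c) - Num.sqrt mu) / 2) <= l.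
  move=> c0 c4; rewrite -[leRHS]mulr1 ler_pM2l //.
  have [_ _ /le_trans->//] := root_gap m0 c0.
  rewrite ler_pdivrMr // mul1r -ler_sqr ?nnegrE ?sqrtr_ge0 // sqr_sqrtr //; lra.
case: ifP => _; last by apply: gap; lra.
by have := gap 4 (ler0n _ _) (lexx _); lra.
Qed.

End Numbers.

(** The purely numerical core: here lam / (8 h) is the square of L once
    h = kappa z. *)
Lemma separation (R : realType) (lam h eta r : R) :
  0 < lam -> 0 <= h -> 0 <= eta -> eta < r ->
  lam * r ^+ 2 <= lam * eta / 2 * r + 2 * h * r ^+ 4 ->
  0 < h /\ lam / (8 * h) <= r ^+ 2.
Proof.
move=> lam0 h0 e0 er E.
have r0 : 0 < r by apply: le_lt_trans er.
have E1 : 3 / 4 * lam < 2 * h * r ^+ 2 + lam / 4.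
  rewrite -(ltr_pM2r (exprn_gt0 2 r0)).
  have := ltr_pM2l (mulr_gt0 lam0 r0) eta r; rewrite er; move: E; nra.
have hp : 0 < h.
  rewrite lt_neqAle h0 andbT eq_sym; apply/eqP => hE.
  by move: E1; rewrite hE; lra.
by split=> //; rewrite ler_pdivrMr ?mulr_gt0 //; lra.
Qed.

(** * Consequences of the minimality of kappa *)

Section Kappa.
Variables (R : realType) (n d : nat) (adj : rel 'I_n).
Implicit Types (p : 'cV[R]_(n * d)) (omega : 'cV[R]_#|edges adj|).

Lemma stress_mx_sym omega : (stress_mx d omega)^T = stress_mx d omega.
Proof.
apply/matrixP => c c'; rewrite !mxE; apply: eq_bigr => e _; congr (_ * _).
by apply: eq_bigr => a _; rewrite mulrC.
Qed.

Lemma kappa_coercive p omega (calC : {vspace 'cV[R]_(n * d)}) kC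
    (C : 'M[R]_(n * d, kC)) (lambda kappa : R) (u : 'cV[R]_(n * d)) :
  let Rp := rigidity_mx adj p in
  orthonormal_basis_of calC C ->
  is_kappa C (stress_mx d omega) Rp lambda kappa ->
  u \in calC ->
  lambda * dot u u <=
    form (stress_mx d omega) u u + 2 * kappa * dot (Rp *m u) (Rp *m u).
Proof.
move=> Rp oC [[_ [_ psdk]] _] uC.
have [y uE yy] := orthonormal_coords oC uC.
have := psdk y; rewrite form_sub_scalar subr_ge0 yy => /le_trans; apply.
rewrite mulmxDr mulmxDl [leLHS]mxE -scalemxAr -scalemxAl.
rewrite [X in _ + X <= _]mxE !dotE uE.
by rewrite !trmx_mul !mulmxA.
Qed.

Lemma kappa_le0 p omega kC (C : 'M[R]_(n * d, kC)) (lambda kappa : R) :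
  is_kappa C (stress_mx d omega) (rigidity_mx adj p) lambda kappa ->
  psd (C^T *m stress_mx d omega *m C - lambda%:M) -> kappa <= 0.
Proof. by case=> _ kmin psd0; apply: kmin; rewrite mulr0 scale0r addr0. Qed.

(** Without edges the rigidity matrix has no rows, so that the feasible t are
    either all t >= 0 or none, and the least one is 0.  A positive kappa
    therefore makes the denominator in L positive. *)
Lemma kappa_gt0_degree p omega kC (C : 'M[R]_(n * d, kC)) (lambda kappa : R) :
  is_kappa C (stress_mx d omega) (rigidity_mx adj p) lambda kappa ->
  0 < kappa -> (0 < max_degree adj)%N.
Proof.
move=> kK; rewrite ltNge lt0n; apply: contraNneq => z0.
apply: (kappa_le0 kK).
have noedge (e : 'I_#|edges adj|) : False.
  have /andP[_ ae] := edgeP e.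
  have := leq_bigmax (F := fun i => #|[set j | adj i j]|) (enum_val e).1.
  rewrite -/(max_degree adj) z0 leqn0 cards_eq0 => /eqP/setP/(_ (enum_val e).2).
  by rewrite !inE ae.
have [[_ psdk] _] := kK; move: psdk.
rewrite (_ : C^T *m _^T *m _ *m C = 0) ?scaler0 ?addr0 //.
rewrite (_ : C^T *m _^T *m _ = 0) ?mul0mx //.
by apply/matrixP => i c; rewrite !mxE big1 // => e _; case: (noedge e).
Qed.

(** If mu0 > lambda, then t = 0 is feasible and kappa = 0.  When mu0 is infinite,
    [fine] sends it to 0, so mubar = 1. *)
Lemma kappa_gt0_mubar p omega kC (C : 'M[R]_(n * d, kC)) (lambda kappa : R) :
  is_kappa C (stress_mx d omega) (rigidity_mx adj p) lambda kappa ->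
  0 < lambda -> 0 < kappa ->
  0 <= mubar_of lambda (lambda_min (C^T *m stress_mx d omega *m C)).
Proof.
move=> kK l0; rewrite ltNge; apply: contraNT; rewrite -ltNge => mneg.
apply: (kappa_le0 kK); apply: psd_sub_lambda_min.
  by rewrite !trmx_mul trmxK stress_mx_sym mulmxA.
move: mneg; rewrite /mubar_of subr_lt0 ltr_pdivlMr // mul1r.
case: lambda_min => [m|_|]; rewrite ?leey //=; first by rewrite lee_fin => /ltW.
by move=> /(lt_trans l0); rewrite ltxx.
Qed.

End Kappa.

Theorem theorem2 (R : realType) (n d : nat)
    (adj : rel 'I_n) (adj_sym : symmetric adj) (adj_irr : irreflexive adj)
    (p : 'cV[R]_(n * d))
    (calC calV : {vspace 'cV[R]_(n * d)})
    (kC kV : nat) (C : 'M[R]_(n * d, kC)) (V : 'M[R]_(n * d, kV))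
    (omega : 'cV[R]_#|edges adj|) (lambda kappa : R) :
  let Rp := rigidity_mx adj p in
  let Omega := stress_mx d omega in
  complementary calC (trivial_flex p) ->
  (forall u, u \in calC -> Rp *m u = 0 -> u \in calV) ->
  (calV <= calC)%VS ->
  orthonormal_basis_of calC C ->
  orthonormal_basis_of calV V ->
  posdef (V^T *m Omega *m V) ->
  0 < lambda ->
  (lambda%:E < lambda_min (V^T *m Omega *m V))%E ->
  is_kappa C Omega Rp lambda kappa ->
  let L := ell (max_degree adj) lambda kappa in
  let mubar := mubar_of lambda (lambda_min (C^T *m Omega *m C)) in
  let eta1 := 4 * enorm (omega^T *m Rp) / lambda in
  let D := D_of L mubar eta1 in
  D < 1 / 2 ->
  let eta2 := eta2_of L mubar eta1 in
  (eta1%:E < eta2)%E /\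
  forall q : 'cV[R]_(n * d),
    q - p \in calC ->
    (forall i j, adj i j -> enorm (pt q i - pt q j) = enorm (pt p i - pt p j)) ->
    eta1 < enorm (q - p) ->
    (eta2 <= (enorm (q - p))%:E)%E.
Proof.
move=> Rp Omega _ _ _ oC _ _ l0 _ kK L mubar eta1 D D12 eta2.
pose z := max_degree adj.
have k0 : 0 <= kappa by case: kK => -[].
have eta0 : 0 <= eta1 by rewrite divr_ge0 ?mulr_ge0 ?enorm_ge0 // ltW.
have sep q : q - p \in calC ->
    (forall i j, adj i j -> enorm (pt q i - pt q j) = enorm (pt p i - pt p j)) ->
    eta1 < enorm (q - p) ->
    0 < kappa * z%:R /\ lambda / (8 * (kappa * z%:R)) <= enorm (q - p) ^+ 2.
  move=> qC qiso; set u := q - p in qC *.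
  have iso (e : 'I_#|edges adj|) : dot (edge_vec (p + u) e) (edge_vec (p + u) e) =
      dot (edge_vec p e) (edge_vec p e).
    have /andP[_ ae] := edgeP e.
    by rewrite /u addrC subrK -!enorm_sqr; congr (_ ^+ 2); apply: qiso.
  move/separation; apply=> //; first by rewrite mulr_ge0.
  rewrite enorm_sqr; apply: le_trans (kappa_coercive oC kK qC) _.
  rewrite -/Rp.
  have -> : lambda * eta1 / 2 = 2 * enorm (omega^T *m Rp).
    by rewrite /eta1; field; rewrite gt_eqF.
  rewrite lerD ?stress_energy_le // -!mulrA ler_pM2l // ler_wpM2l //.
  exact: rigidity_isometric_le.
have [kz|k_gt0] := leP kappa 0.
  have k_eq0 : kappa = 0 by apply/eqP; rewrite eq_le kz k0.
  rewrite /eta2 /L /ell k_eq0 eqxx /= ltey; split=> // q qC qiso eq.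
  by have [] := sep q qC qiso eq; rewrite k_eq0 mul0r ltxx.
have z0 : 0 < z%:R :> R by rewrite ltr0n; apply: kappa_gt0_degree kK k_gt0.
have m0 : 0 <= mubar := kappa_gt0_mubar kK l0 k_gt0.
have kz0 : 0 < 8 * z%:R * kappa by rewrite !mulr_gt0.
have LE : L = (Num.sqrt (lambda / (8 * z%:R * kappa)))%:E by rewrite /L /ell gt_eqF.
have ell0 : 0 < Num.sqrt (lambda / (8 * z%:R * kappa)).
  by rewrite sqrtr_gt0 divr_gt0.
rewrite /eta2 /D LE in D12 *; split; first exact: eta1_lt_eta2.
move=> q qC qiso eq; apply: le_trans (eta2_le ell0 m0 eta0) _.
rewrite lee_fin -ler_sqr ?nnegrE ?enorm_ge0 ?(ltW ell0) //.
rewrite sqr_sqrtr; last by rewrite ltW // divr_gt0.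
by have [_] := sep q qC qiso eq; rewrite [kappa * _]mulrC mulrA.
Qed.
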